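(* The value $\operatorname{bdim}(G)-\operatorname{bdim}(G-e)$ can be arbitrarily large: for every $M$ there exist a connected graph $G$ and an edge $e\in E(G)$ such that $G-e$ is connected and $\operatorname{bdim}(G)-\operatorname{bdim}(G-e)\ge M$.
   Context: All graphs are finite, simple and undirected. $d(u,v)$ denotes graph distance, and for a positive integer $k$, $d_k(u,v)=\min\{d(u,v),k+1\}$. A function $f:V(G)\to\mathbb{Z}_{\ge0}$ is a resolving broadcast of $G$ if for any distinct $x,y\in V(G)$ there is $z$ with $f(z)>0$ and $d_{f(z)}(x,z)\ne d_{f(z)}(y,z)$; $\operatorname{bdim}(G)$ is the minimum of $\sum_v f(v)$ over resolving broadcasts $f$ of $G$. $G-e$ denotes $G$ with the edge $e$ removed. *)

(* Defs.v *)
From mathcomp Require Import all_boot.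

Set Implicit Arguments.
Unset Strict Implicit.
Unset Printing Implicit Defensive.

Record sgraph := SGraph {
  vertex :> finType;
  adj : rel vertex;
  adj_sym : symmetric adj;
  adj_irr : irreflexive adj }.

Definition connected (G : sgraph) : Prop := forall x y : G, connect (@adj G) x y.

Section EdgeDeletion.
Variables (G : sgraph) (u v : G).

Definition del_adj : rel G :=
  [rel x y | adj x y && ~~ ((x == u) && (y == v) || (x == v) && (y == u))].

Lemma del_adj_sym : symmetric del_adj.
Proof. by move=> x y; rewrite /del_adj /= adj_sym orbC ![(y == _) && _]andbC. Qed.

Lemma del_adj_irr : irreflexive del_adj.
Proof. by move=> x; rewrite /del_adj /= adj_irr. Qed.

Definition del_edge : sgraph := SGraph del_adj_sym del_adj_irr.

End EdgeDeletion.

Section Broadcast.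
Variable G : sgraph.
Implicit Types (x y z : G) (f : G -> nat) (k n : nat).

Definition walk n x y : bool :=
  [exists p : n.-tuple G, path (@adj G) x p && (last x p == y)].

(* The length of a shortest walk; such a walk has fewer than #|G| edges.
   The value is #|G| when y is not reachable from x. *)
Definition dist x y : nat := find (fun n => walk n x y) (iota 0 #|G|).

(* The distance between vertices of different components is infinite, so that
   its truncation is k.+1. *)
Definition tdist k x y : nat :=
  if connect (@adj G) x y then minn (dist x y) k.+1 else k.+1.

Definition resolving f : bool :=
  [forall x, forall y, (x != y) ==>
     [exists z, (0 < f z) && (tdist (f z) x z != tdist (f z) y z)]].

(* The values of a broadcast of cost n are at most n; bdimP below shows that
   this bound on the range loses nothing. *)
Definition has_broadcast n : bool :=
  [exists f : {ffun G -> 'I_n.+1},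
    resolving (fun x => val (f x)) && (\sum_x val (f x) == n)].

Lemma dist_eq0 x y : (dist x y == 0) = (x == y).
Proof.
have G_gt0 : 0 < #|G| by apply/card_gt0P; exists x.
rewrite /dist -(prednK G_gt0) /=.
have -> : walk 0 x y = (x == y).
  apply/existsP/idP => [[p]|xy]; first by rewrite (tuple0 p).
  by exists [tuple].
by case: (x == y).
Qed.

Lemma eq_resolving f g : f =1 g -> resolving f = resolving g.
Proof.
move=> fg; apply: eq_forallb => x; apply: eq_forallb => y.
by congr (_ ==> _); apply: eq_existsb => z; rewrite fg.
Qed.

Lemma resolving1 : resolving (fun=> 1).
Proof.
apply/forallP => x; apply/forallP => y; apply/implyP => xy.
apply/existsP; exists x => /=.
rewrite /tdist connect0 (eqP (_ : dist x x == 0)) ?dist_eq0 // min0n.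
rewrite eq_sym -lt0n; case: ifP => // _.
by rewrite leq_min lt0n dist_eq0 eq_sym xy.
Qed.

Lemma has_broadcast_resolving f :
  resolving f -> has_broadcast (\sum_x f x).
Proof.
move=> fr; have f_lt x : f x < (\sum_x f x).+1.
  by rewrite ltnS (bigD1 x) //= leq_addr.
apply/existsP; exists [ffun x => Ordinal (f_lt x)].
rewrite (@eq_resolving _ f) ?fr /=; last by move=> x; rewrite ffunE.
by apply/eqP/eq_bigr => x _; rewrite ffunE.
Qed.

Lemma ex_has_broadcast : exists n, has_broadcast n.
Proof. by exists (\sum_(x : G) 1); exact: has_broadcast_resolving resolving1. Qed.

Definition bdim : nat := ex_minn ex_has_broadcast.

Lemma bdimP :
  (exists2 f, resolving f & \sum_x f x = bdim) /\
  (forall f, resolving f -> bdim <= \sum_x f x).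
Proof.
rewrite /bdim; case: ex_minnP => n /existsP[f /andP[fr /eqP fn]] nmin; split.
  by exists (fun x => val (f x)).
by move=> g gr; apply: nmin; exact: has_broadcast_resolving.
Qed.

End Broadcast.

Lemma walkP (G : sgraph) n (x y : G) :
  reflect (exists p, [/\ path (@adj G) x p, last x p = y & size p = n])
          (walk n x y).
Proof.
apply: (iffP existsP) => [[p /andP[pp /eqP py]]|[p [pp py /eqP pn]]].
  by exists p; rewrite size_tuple.
by exists (Tuple pn); rewrite /= pp py eqxx.
Qed.

Lemma distP (G : sgraph) (x y : G) : connect (@adj G) x y ->
  walk (dist x y) x y /\ (forall n, walk n x y -> dist x y <= n).
Proof.
case/connectP=> p0 p0p p0y; case/shortenP: p0p p0y => p pp pu _ py.
have hasw : has (fun n => walk n x y) (iota 0 #|G|).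
  apply/hasP; exists (size p); last by apply/walkP; exists p.
  rewrite mem_iota /= add0n; have := max_card (mem (x :: p)).
  by rewrite (card_uniqP pu).
have lt_d : dist x y < #|G| by rewrite -[X in _ < X](size_iota 0) -has_find.
split=> [|n wn]; first by have := nth_find 0 hasw; rewrite nth_iota.
rewrite leqNgt; apply/negP => lt_n.
by have := before_find 0 lt_n; rewrite nth_iota ?(ltn_trans lt_n) // add0n wn.
Qed.

(* Main.v *)
Require Import Defs.
From mathcomp Require Import all_boot.

(** G consists of two adjacent hubs h1 = [hub true] and h2 = [hub false] and of
    m cells {a, b, c, w}, with edges wa, wb, wc, ac inside each cell, a and b
    joined to h1, and c joined to h2; the deleted edge is e = h1h2.

    In G - e the hubs determine the position of a vertex inside its cell: only b
    is at distance 3 from h2.  So range 1 at h1 and at every w and range 2 at h2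
    resolve all pairs, at cost m + 3.

    In G, the vertices a and b of a cell are at equal distances from w and from
    everything outside the cell.  A cell of cost at most 1 therefore has its
    landmark at a, b or c, and this landmark cannot see b or cannot see c.  Two
    cells that both fail to see their b (or their c) leave these two vertices
    unresolved, so all but at most two cells cost at least 2, and
    bdim G >= 2 m - 4. *)

Set Implicit Arguments.
Unset Strict Implicit.
Unset Printing Implicit Defensive.

(** * Distances in an arbitrary graph *)

Section Distances.
Variable G : sgraph.
Implicit Types (x y z : G) (k n : nat).

Lemma walkS n x y z : adj x y -> walk n y z -> walk n.+1 x z.
Proof.
move=> xy /walkP[p [py pz pn]]; apply/walkP; exists (y :: p).
by rewrite /= xy py pz pn.
Qed.

(** Along a walk [D] drops by at most one per step, so a walk from [x] to [z] has at least [D x]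
    edges; the last condition gives a descent with exactly that many. *)
Lemma dist_potential z (D : G -> nat) :
    D z = 0 -> (forall x y, adj x y -> D x <= (D y).+1) ->
    (forall x, x != z -> exists2 y, adj x y & D x = (D y).+1) ->
  forall x, connect (@adj G) x z /\ dist x z = D x.
Proof.
move=> Dz Dlip Ddown.
have walkD x : walk (D x) x z.
  move: {2}(D x) (erefl (D x)) => n; elim: n x => [|n IHn] x Dx.
    rewrite Dx; apply/walkP; exists [::]; split=> //=; apply/eqP.
    by case: eqVneq => // /Ddown[y _]; rewrite Dx.
  have /Ddown[y xy]: x != z by apply: contra_eq_neq Dx => ->; rewrite Dz.
  by rewrite Dx => -[Dy]; rewrite {1}Dy; apply: walkS xy (IHn y _).
have leD n x : walk n x z -> D x <= n.
  case/walkP=> p [px pz <-] {n}; elim: p x px pz => [|y p IHp] x /=.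
    by move=> _ ->; rewrite Dz.
  by case/andP=> /Dlip Dxy /IHp IH /IH Dy; rewrite (leq_trans Dxy).
move=> x; have /walkP[p [px pz _]] := walkD x.
have xz : connect (@adj G) x z by apply/connectP; exists p.
have [wd dmin] := distP xz; split=> //; apply/eqP.
by rewrite eqn_leq dmin ?walkD // leD.
Qed.

Lemma tdist_eq0 k x z : (tdist k x z == 0) = (x == z).
Proof.
rewrite /tdist; case: ifPn => [_|].
  by rewrite -leqn0 geq_min ltn0 orbF leqn0 dist_eq0.
by apply: contraNeq => /negPn/eqP->.
Qed.

Lemma tdist_le1 k x z : 0 < k -> (tdist k x z <= 1) = (x == z) || adj x z.
Proof.
move=> k_gt0; case: eqVneq => [->|xz] /=.
  by rewrite leq_eqVlt ltnS leqn0 tdist_eq0 eqxx orbT.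
rewrite /tdist; case: ifPn => [c_xz|]; last first.
  rewrite leqNgt ltnS k_gt0 => nxz; apply/esym.
  by apply: contraNF nxz; exact: connect1.
rewrite geq_min [k.+1 <= 1]leqNgt ltnS k_gt0 orbF.
have [/walkP[p [px pz pn]] dmin] := distP c_xz.
apply/idP/idP => [|xz1]; last first.
  by apply: dmin; apply/walkP; exists [:: z]; rewrite /= xz1.
move: px pz xz; rewrite -pn; case: p {pn} => [|y []] //= px.
  by move=> ->; rewrite eqxx.
by move: px; rewrite andbT => xy <-.
Qed.

(** Truncation at a positive range preserves closed neighbourhoods, so adjacency alone can certify a
    separation. *)
Lemma tdist_adj_neq k x y z : 0 < k ->
  (x == z) || adj x z != (y == z) || adj y z -> tdist k x z != tdist k y z.
Proof.
by move=> k_gt0; apply: contraNneq => txy; rewrite -!(tdist_le1 _ _ k_gt0) txy.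
Qed.

(** A landmark is the only vertex at distance 0 from itself, hence separates itself from all
    others. *)
Lemma resolving_pos f :
  (forall x y, x != y -> f x = 0 -> f y = 0 ->
     exists2 z, 0 < f z & tdist (f z) x z != tdist (f z) y z) -> resolving f.
Proof.
move=> fP; apply/forallP => x; apply/forallP => y; apply/implyP => xy.
have sep z : tdist (f z) z z = 0 by apply/eqP; rewrite tdist_eq0.
apply/existsP; case: (posnP (f x)) => [fx0|fx]; last first.
  by exists x; rewrite fx sep eq_sym tdist_eq0 eq_sym xy.
case: (posnP (f y)) => [fy0|fy]; last by exists y; rewrite fy sep tdist_eq0 xy.
by have [z fz xyz] := fP x y xy fx0 fy0; exists z; rewrite fz.
Qed.

End Distances.

(** * The graph G and its metric *)

Notation cell := (bool * bool)%type.
(** The first bit marks the neighbours a, b of h1, the second the ends of the edge ac. *)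
Notation va := (true, true).
Notation vb := (true, false).
Notation vc := (false, true).
Notation vw := (false, false).

Definition hub_dist (h : bool) (s : cell) : nat :=
  if (if h then s.1 else s == vc) then 1 else 2.

Definition cell_dist (s t : cell) : nat :=
  if s == t then 0 else if [|| s == vw, t == vw | s.2 && t.2] then 1 else 2.

Section Construction.
Variable m : nat.

Definition vtx : finType := (bool + 'I_m * cell)%type.

(* Adjacency in G is defined below as being at [gdist] 1; [gdist] is the resulting
   graph distance. *)
Definition gdist (x y : vtx) : nat :=
  match x, y with
  | inl h, inl h' => h != h'
  | inl h, inr (_, s) | inr (_, s), inl h => hub_dist h s
  | inr (i, s), inr (j, t) =>
      if i == j then cell_dist s t else
      minn (hub_dist true s + hub_dist true t)
           (hub_dist false s + hub_dist false t)
  end.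

Lemma gdist_sym x y : gdist x y = gdist y x.
Proof.
case: x y => [h|[i s]] [h'|[j t]] //=; first by rewrite eq_sym.
rewrite eq_sym; case: eqP => _; last by rewrite addnC [X in minn _ X]addnC.
by case: s t => [[] []] [[] []].
Qed.

Lemma gdistxx x : gdist x x = 0.
Proof. by case: x => [h|[i s]] /=; rewrite ?eqxx // /cell_dist eqxx. Qed.

Definition gadj : rel vtx := [rel x y | gdist x y == 1].

Lemma gadj_sym : symmetric gadj.
Proof. by move=> x y; rewrite /gadj /= gdist_sym. Qed.

Lemma gadj_irr : irreflexive gadj.
Proof. by move=> x; rewrite /gadj /= gdistxx. Qed.

Definition ggraph := SGraph gadj_sym gadj_irr.

Definition hub (h : bool) : ggraph := inl h.
Definition cvtx (i : 'I_m) (s : cell) : ggraph := inr (i, s).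

Ltac step y := by exists y; rewrite //= /gadj /= ?eqxx;
  repeat match goal with E : (_ == _) = false |- _ => rewrite E end.

(** Between cells, crossing e never shortens a path: the two hub distances of a cell vertex differ
    by at most 1. *)
Lemma dist_ggraph (x z : ggraph) :
  connect (@adj ggraph) x z /\ dist x z = gdist x z.
Proof.
apply: (@dist_potential ggraph z (gdist^~ z)) x; first exact: gdistxx.
  case: z => [l|[k u]] [h|[i s]] [h'|[j t]]; rewrite /= /gadj /=.
  - by case: l h h' => [] [] [].
  - by case: l h t => [] [] [[] []].
  - by case: l h' s => [] [] [[] []].
  - by case: (i == j); case: l s t => [] [[] []] [[] []].
  - by case: h h' u => [] [] [[] []].
  - by case: (j == k); case: h t u => [] [[] []] [[] []].
  - by case: (i == k); case: h' s u => [] [[] []] [[] []].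
  have [->|ij] := eqVneq i j.
    by case: (j == k); case: s t u => [[] []] [[] []] [[] []].
  (* Distinct cells are at distance at least 2, so no edge joins them. *)
  by case: s t => [[] []] [[] []].
case: z => [l|[k u]] [h|[i s]] xz.
- by exists (hub l); move: xz; case: l h => [] [].
- by case: l s {xz} => [] [[] []];
    first [step (hub true) | step (hub false)
          | step (cvtx i va) | step (cvtx i vc)].
- by case: h u {xz} => [] [[] []];
    first [step (hub true) | step (hub false)
          | step (cvtx k va) | step (cvtx k vb) | step (cvtx k vc)].
have [ik|/negPf nik] := eqVneq i k.
  move: xz; rewrite {}ik; case: s u => [[] []] [[] []]; rewrite ?eqxx // => _;
    first [step (cvtx k va) | step (cvtx k vb)
          | step (cvtx k vc) | step (cvtx k vw)].
case: s u {xz} => [[] []] [[] []];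
  first [step (hub true) | step (hub false) | step (cvtx i va) | step (cvtx i vc)].
Qed.

Lemma connected_ggraph : connected ggraph.
Proof. by move=> x z; have [] := dist_ggraph x z. Qed.

Lemma tdist_ggraph k (x z : ggraph) : tdist k x z = minn (gdist x z) k.+1.
Proof. by have [xz <-] := dist_ggraph x z; rewrite /tdist xz. Qed.

(** * Lower bound for broadcasts of G *)

Section LowerBound.
Variable f : ggraph -> nat.
Hypothesis f_res : resolving f.

(* Distances inside a cell are at most 2, so the last condition puts [t] out of
   the range 1 of the landmark [s]. *)
Definition misses (i : 'I_m) (t : cell) : bool :=
  [forall s, (0 < f (cvtx i s)) ==>
     (f (cvtx i s) == 1) && (cell_dist t s == 2)].

Lemma resolvedP (x y : ggraph) : x != y ->
  exists2 z, 0 < f z & minn (gdist x z) (f z).+1 != minn (gdist y z) (f z).+1.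
Proof.
move=> xy; have /implyP/(_ xy)/existsP[z] := forallP (forallP f_res x) y.
by rewrite !tdist_ggraph => /andP[]; exists z.
Qed.

(** A landmark in either cell reads 2 at both copies of [t]: at its own by [misses], at the other
    because cells are 2 apart. All other landmarks are equidistant from the copies. *)
Lemma misses_inj i j t : misses i t -> misses j t -> i = j.
Proof.
move=> /forallP mi /forallP mj; apply/eqP/contraT => ij.
have far k l s : k != l -> minn (gdist (cvtx k t) (cvtx l s)) 2 = 2.
  by move=> /negPf /= ->; case: t s {mi mj} => [[] []] [[] []].
have [|[h|[k s]] fz] := @resolvedP (cvtx i t) (cvtx j t).
- by apply: contraNneq ij => -[->].
- by rewrite eqxx.
have [ki|ki] := eqVneq i k; have [kj|kj] := eqVneq j k.
- by rewrite ki kj eqxx in ij.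
- subst k; have /implyP/(_ fz)/andP[/eqP-> /eqP it] := mi s.
  by rewrite (far j) //= eqxx it.
- subst k; have /implyP/(_ fz)/andP[/eqP-> /eqP it] := mj s.
  by rewrite (far i) //= eqxx it.
by rewrite /= (negPf ki) (negPf kj) eqxx.
Qed.

Definition weight (i : 'I_m) : nat := \sum_s f (cvtx i s).

(** Separating a from b forces a landmark at a, b or c, which is then the only one in the cell and
    has range 1. From a or c it misses b; from b it misses c. *)
Lemma light_misses i : weight i <= 1 -> misses i vb || misses i vc.
Proof.
move=> wi; have fw1 s : f (cvtx i s) <= 1.
  by apply: leq_trans wi; rewrite /weight (bigD1 s) //= leq_addr.
have fw2 s t : s != t -> 0 < f (cvtx i s) -> f (cvtx i t) = 0.
  move=> st fs; move: wi; rewrite /weight (bigD1 s) //= (bigD1 t) 1?eq_sym //=.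
  by move: fs; case: (f _) (f _) => [|a] [|b] //; rewrite addSn addnS.
have only u t : 0 < f (cvtx i u) -> cell_dist t u == 2 -> misses i t.
  move=> fu tu; apply/forallP => s; apply/implyP => fs.
  have [->|su] := eqVneq s u; first by rewrite tu eqn_leq fw1 fu.
  by rewrite (fw2 u s) 1?eq_sym in fs.
have [|[h|[k s]] fz] := @resolvedP (cvtx i va) (cvtx i vb).
- by apply/eqP => -[].
- by case: h {fz}; rewrite eqxx.
have [ik|/negPf ik] := eqVneq i k; last first.
  by rewrite /= ik; case: s {fz} => [[] []]; rewrite eqxx.
subst k; rewrite /= eqxx; case: s fz => [[] []] fz; rewrite ?eqxx // => _.
- by rewrite (only va vb).
- by rewrite orbC (only vb vc).
- by rewrite (only vc vb).
Qed.

Lemma bound_weight : 2 * m <= \sum_x f x + 4.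
Proof.
pose B := [set i | weight i <= 1].
have missing t : #|[set i | misses i t]| <= 1.
  apply/card_le1_eqP => i j; rewrite !inE => mi mj; exact: misses_inj mj mi.
have Bsub : B \subset [set i | misses i vb] :|: [set i | misses i vc].
  by apply/subsetP => i; rewrite !inE; exact: light_misses.
have B2 : #|B| <= 2.
  apply: leq_trans (subset_leq_card Bsub) _.
  by rewrite (leq_trans (leq_card_setU _ _)) // (leq_add (missing _)).
have W : \sum_i weight i <= \sum_x f x.
  rewrite big_sumType /= (leq_trans _ (leq_addl _ _)) //.
  by rewrite /weight pair_bigA; apply/eq_leq/eq_bigr => -[].
(* Cells outside [B] weigh at least 2; those in [B] are paid for by the second term. *)
have sumB : 2 * m <= \sum_i weight i + 2 * #|B|.
  rewrite -sum1_card big_distrr /= [X in _ + X]big_mkcond -big_split /=.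
  rewrite mulnC -[X in X * 2]card_ord -sum_nat_const; apply: leq_sum => i _.
  by rewrite inE; have [wi|wi] := leqP (weight i) 1; rewrite ?leq_addl ?addn0.
apply: leq_trans sumB (leq_add W _); exact: (@leq_mul 2 _ 2 2).
Qed.

End LowerBound.

(** * A cheap broadcast of G - e *)

Hypothesis m_gt0 : 0 < m.
Local Notation G' := (del_edge (hub true) (hub false)).

(** Without e, h2 is reached only through some c: from h1 via a, c and from b via w, c. *)
Definition del_hub_dist (x : G') : nat :=
  match x with
  | inl h => if h then 3 else 0
  | inr (_, s) => if s == vb then 3 else hub_dist false s
  end.

Lemma dist_del_hub (x : G') :
  connect (@adj G') x (hub false) /\ @dist G' x (hub false) = del_hub_dist x.
Proof.
apply: (@dist_potential G' (hub false) del_hub_dist) x => //.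
  case=> [h|[i s]] [h'|[j t]]; rewrite /= /del_adj /= /gadj /=.
  - by case: h h' => [] [].
  - by case: h t => [] [[] []].
  - by case: h' s => [] [[] []].
  - by case: (i == j); case: s t => [[] []] [[] []].
case=> [[] // _|[i s] _].
  by exists (inr (Ordinal m_gt0, va)).
case: s => [[] []].
- by exists (inr (i, vc)); rewrite //= /del_adj /= /gadj /= eqxx.
- by exists (inr (i, vw)); rewrite //= /del_adj /= /gadj /= eqxx.
- by exists (inl false).
- by exists (inr (i, vc)); rewrite //= /del_adj /= /gadj /= eqxx.
Qed.

Lemma connected_del_ggraph : connected G'.
Proof.
move=> x y; have [xh _] := dist_del_hub x; have [yh _] := dist_del_hub y.
by apply: connect_trans xh _; rewrite (sym_connect_sym (@adj_sym G')).
Qed.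

Definition del_broadcast (x : G') : nat :=
  match x with inl h => if h then 1 else 2 | inr (_, s) => s == vw end.

Lemma sum_del_broadcast : \sum_x del_broadcast x = m + 3.
Proof.
rewrite big_sumType big_bool /= addnC; congr (_ + _).
transitivity (\sum_(i < m) \sum_(s : cell) nat_of_bool (s == vw)).
  by rewrite pair_bigA; apply: eq_bigr => -[].
rewrite -[RHS]muln1 -[X in X * 1]card_ord -sum_nat_const; apply: eq_bigr => i _.
by rewrite (bigD1 vw) //= big1 // => s /negPf->.
Qed.

Lemma resolving_del_broadcast : resolving del_broadcast.
Proof.
apply: resolving_pos => -[[]|[i s]] [[]|[j t]] //= xy sw tw.
have [ij|/negPf ij] := eqVneq i j; last first.
  (* This w is adjacent to the rest of its own cell and to nothing outside it. *)
  exists (cvtx i vw) => //=; apply: tdist_adj_neq => //.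
  rewrite /= /del_adj /= /gadj /= [j == i]eq_sym ij eqxx.
  have -> : (inr (j, t) == cvtx i vw) = false.
    by apply: contraFF ij => /eqP[->].
  by move: s t sw {xy tw} => [[] []] [[] []] //= _; rewrite orbT.
subst j; have h2 (x : G') : tdist 2 x (hub false) = minn (del_hub_dist x) 3.
  by have [xh <-] := dist_del_hub x; rewrite /tdist xh.
move: s t xy sw tw => [[] []] [[] []] //; rewrite ?eqxx // => _ _ _;
  (* Adjacency to h1 separates c from a and b. For a and b, at distances 2 and 3 from h2, range 2
     suffices as it truncates at 3. *)
  first [by exists (hub true); rewrite // tdist_adj_neq
        | by exists (hub false); rewrite //= !h2].
Qed.

End Construction.

Theorem theorem1p8 :
  forall M : nat,
  exists (G : sgraph) (u v : G),
    [/\ adj u v,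
        connected G,
        connected (del_edge u v) &
        M + bdim (del_edge u v) <= bdim G].
Proof.
(* The choice of [m] makes [2 * m - 4] equal to [M + (m + 3)]. *)
move=> M; pose m := M + 7; have m_gt0 : 0 < m by rewrite /m addnS.
exists (ggraph m), (hub m true), (hub m false); split=> //.
- exact: connected_ggraph.
- exact: connected_del_ggraph m_gt0.
have [[f fr <-] _] := bdimP (ggraph m).
have [_ /(_ _ (resolving_del_broadcast m_gt0))] :=
  bdimP (del_edge (hub m true) (hub m false)).
rewrite sum_del_broadcast -(leq_add2l M) => /leq_trans; apply.
rewrite -(leq_add2r 4); apply: leq_trans (bound_weight fr).
by rewrite mul2n -addnn [M + _]addnCA -!addnA.
Qed.
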